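(* For $K=2$ users and $N=2$ files, every memory-rate pair $(M,R)$ on the piecewise linear curve obtained by joining consecutively the points $(0,2)$, $(2/3,1)$, $(1,2/3)$, $(2,0)$ by straight line segments is achievable, that is, there exists a $(2,2;M,R)$ demand-private coded caching scheme. At the points $(1,2/3)$ and $(2/3,1)$ this is achieved by schemes with subpacketization three; for the schemes on the straight line segments the subpacketization need not be three.
   Context: A $(K,N;M,R)$ coded caching scheme: a server has $N$ files $W_0,\dots,W_{N-1}$ of $F$ bits each and is connected by a multicast link to $K$ users $0,\dots,K-1$, each with a cache of $MF$ bits. Placement phase: without knowing the demands, the server populates the cache of User $i$ with content $Z_i$ (of $MF$ bits) derived from the files, and also sends User $i$ a header $\Theta(Z_i)$ describing how $Z_i$ was derived from the files; this takes place over a private link between the server and User $i$, and the server may choose the cache contents at random. Delivery phase: User $i$ requests file $W_{D_i}$; the demands $D_i$ are i.i.d. uniform on $\{0,\dots,N-1\}$ and are sent to the server over private links. Depending on the demand vector $D=(D_0,\dots,D_{K-1})$ and the caches, the server multicasts a transmission $X^D$ of $RF$ bits and a header $\Theta(X^D)$ containing information about the transmission needed for decoding. Headers are assumed small compared to the file size and are not counted in $M$ and $R$. Decodability: $H(W_{D_i}\mid Z_i,\Theta(Z_i),X^D,\Theta(X^D))=0$ for every user $i$. The scheme is demand-private (or private) if $I(D_i,Z_i,\Theta(Z_i),X^D,\Theta(X^D);D_j)=0$ for all $i\ne j$. The subpacketization is the number of parts (subfiles) into which each file is divided. A file of $F$ bits may be split into two parts of $\alpha F$ and $(1-\alpha)F$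 bits for any $0\le\alpha\le 1$. *)

(* Defs.v *)
From HB Require Import structures.
From mathcomp Require Import all_boot all_order all_algebra.
From mathcomp Require Import all_classical all_reals all_analysis.

Set Implicit Arguments.
Unset Strict Implicit.
Unset Printing Implicit Defensive.

Import Order.TTheory GRing.Theory Num.Theory.

Local Open Scope ring_scope.

(** * Entropy and mutual information of finite random variables

    [P : Om -> R] is a probability mass function on a finite sample space and
    random variables are functions on [Om]. Since [ln 0 = 0] and [x / 0 = 0],
    the summands of probability zero vanish, which is the usual convention
    [0 log 0 = 0]. *)

Definition log2 (R : realType) (x : R) : R := ln x / ln 2.

Definition rv_pmf (R : realType) (Om A : finType) (P : Om -> R) (X : Om -> A)
    (a : A) : R :=
  \sum_(w | X w == a) P w.

(* H(X | Y) = - sum_(x, y) p(x, y) log (p(x, y) / p(y)) *)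
Definition cond_entropy (R : realType) (Om A B : finType) (P : Om -> R)
    (X : Om -> A) (Y : Om -> B) : R :=
  - \sum_(x : A) \sum_(y : B)
      (let pxy := rv_pmf P (fun w => (X w, Y w)) (x, y) in
       pxy * log2 (pxy / rv_pmf P Y y)).

(* I(X ; Y) = sum_(x, y) p(x, y) log (p(x, y) / (p(x) p(y))) *)
Definition mutual_info (R : realType) (Om A B : finType) (P : Om -> R)
    (X : Om -> A) (Y : Om -> B) : R :=
  \sum_(x : A) \sum_(y : B)
      (let pxy := rv_pmf P (fun w => (X w, Y w)) (x, y) in
       pxy * log2 (pxy / (rv_pmf P X x * rv_pmf P Y y))).

(** * Coded caching schemes *)

Definition files (N F : nat) : finType := {ffun 'I_N -> 'rV['F_2]_F}.

Definition demands (K N : nat) : finType := {ffun 'I_K -> 'I_N}.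

(** A scheme for [K] users and [N] files of [F] bits. All the randomness of the
    server, in both phases, is in [seed]; the cache contents do not depend on
    the demands. A header says how the content it accompanies was formed from
    the files, so it is a function of the seed (and, in the delivery phase, of
    the demands) but not of the bits of the files. *)
Record scheme (R : realType) (K N F : nat) := Scheme {
  seed : finType;
  seed_pmf : seed -> R;
  seed_pmf_ge0 : forall s, 0 <= seed_pmf s;
  seed_pmf_sum1 : \sum_s seed_pmf s = 1;
  cache_bits : nat;
  tx_bits : nat;
  cache_header : finType;
  tx_header : finType;
  cache : 'I_K -> seed -> files N F -> 'rV['F_2]_cache_bits;
  cache_head : 'I_K -> seed -> cache_header;
  tx : demands K N -> seed -> files N F -> 'rV['F_2]_tx_bits;
  tx_head : demands K N -> seed -> tx_header
}.

Section SchemeProperties.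
Context (R : realType) (K N F : nat) (c : scheme R K N F).

Definition outcome : finType := (seed c * files N F * demands K N)%type.

(* The seed, the files and the demands are independent; files and demand
   vectors are uniformly distributed. *)
Definition outcome_pmf (w : outcome) : R :=
  seed_pmf w.1.1 / (#|files N F|%:R * #|demands K N|%:R).

Definition rv_demand (i : 'I_K) (w : outcome) : 'I_N := w.2 i.

(* W_{D_i} *)
Definition rv_demanded_file (i : 'I_K) (w : outcome) : 'rV['F_2]_F :=
  w.1.2 (w.2 i).

(* (Z_i, Theta(Z_i), X^D, Theta(X^D)) *)
Definition rv_received (i : 'I_K) (w : outcome) :
    'rV['F_2]_(cache_bits c) * cache_header c * 'rV['F_2]_(tx_bits c)
      * tx_header c :=
  (cache i w.1.1 w.1.2, cache_head i w.1.1,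
   tx w.2 w.1.1 w.1.2, tx_head w.2 w.1.1).

Definition decodable : Prop :=
  forall i : 'I_K,
    cond_entropy outcome_pmf (rv_demanded_file i) (rv_received i) = 0.

Definition demand_private : Prop :=
  forall i j : 'I_K, i != j ->
    mutual_info outcome_pmf (fun w => (rv_demand i w, rv_received i w))
      (rv_demand j) = 0.

End SchemeProperties.

(** [(M, r)] is achievable if there are demand-private schemes with caches of
    [M F] bits and transmissions of [r F] bits (rounded up to an integer) and
    headers of at most [eps F] bits, for every [eps > 0]. The file size [F] can
    be taken divisible by any prescribed [d > 0]: it is in particular
    arbitrarily large, so that the rounding is negligible, and for rational [M]
    and [r] there is no rounding at all when [d] is a common denominator. *)
Definition achievable (R : realType) (K N : nat) (M r : R) : Prop :=
  forall (eps : R) (d : nat), 0 < eps -> (0 < d)%N ->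
  exists F : nat, exists c : scheme R K N F,
    [/\ (0 < F)%N /\ (d %| F)%N,
        decodable c /\ demand_private c,
        Posz (cache_bits c) = Num.ceil (M * F%:R)
          /\ Posz (tx_bits c) = Num.ceil (r * F%:R),
        log2 (#|cache_header c|%:R : R) <= eps * F%:R
      & log2 (#|tx_header c|%:R : R) <= eps * F%:R].

(** * Subpacketization

    With subpacketization [P], each file is divided into [P] subfiles of the
    same length, and the caches and transmissions consist of packets of that
    length, each of which is a sum over F_2 (an exclusive or) of subfiles. A
    packet is described by the matrix in ['M['F_2]_(N, P)] whose entry [(n, j)]
    says whether subfile [j] of file [n] occurs in it. The description,
    including the headers, does not involve the length of the subfiles. *)
Record packet_scheme (R : realType) (K N P : nat) := PacketScheme {
  pk_seed : finType;
  pk_seed_pmf : pk_seed -> R;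
  pk_seed_pmf_ge0 : forall s, 0 <= pk_seed_pmf s;
  pk_seed_pmf_sum1 : \sum_s pk_seed_pmf s = 1;
  cache_packets : nat;
  tx_packets : nat;
  pk_cache_header : finType;
  pk_tx_header : finType;
  cache_coef : 'I_K -> pk_seed -> 'I_cache_packets -> 'M['F_2]_(N, P);
  pk_cache_head : 'I_K -> pk_seed -> pk_cache_header;
  tx_coef : demands K N -> pk_seed -> 'I_tx_packets -> 'M['F_2]_(N, P);
  pk_tx_head : demands K N -> pk_seed -> pk_tx_header
}.

Definition subfile (N P L : nat) (W : files N (P * L)) (n : 'I_N) (j : 'I_P) :
    'rV['F_2]_L :=
  row j (vec_mx (W n)).

Definition packet (N P L : nat) (a : 'M['F_2]_(N, P)) (W : files N (P * L)) :
    'rV['F_2]_L :=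
  \sum_(n < N) \sum_(j < P) a n j *: subfile W n j.

Definition concat_packets (N P L m : nat) (a : 'I_m -> 'M['F_2]_(N, P))
    (W : files N (P * L)) : 'rV['F_2]_(m * L) :=
  mxvec (\matrix_(k < m) packet (a k) W).

Definition with_subfile_length (R : realType) (K N P : nat)
    (q : packet_scheme R K N P) (L : nat) : scheme R K N (P * L) :=
  {| seed := pk_seed q;
     seed_pmf := @pk_seed_pmf R K N P q;
     seed_pmf_ge0 := @pk_seed_pmf_ge0 R K N P q;
     seed_pmf_sum1 := @pk_seed_pmf_sum1 R K N P q;
     cache_bits := cache_packets q * L;
     tx_bits := tx_packets q * L;
     cache_header := pk_cache_header q;
     tx_header := pk_tx_header q;
     cache := fun i s W => concat_packets (cache_coef i s) W;
     cache_head := @pk_cache_head R K N P q;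
     tx := fun D s W => concat_packets (tx_coef D s) W;
     tx_head := @pk_tx_head R K N P q |}.

(* The caches have M F bits and the transmissions r F bits exactly, F = P L. *)
Definition achieved_with_subpacketization (R : realType) (K N P : nat)
    (M r : R) : Prop :=
  exists q : packet_scheme R K N P,
    [/\ (cache_packets q)%:R = M * P%:R,
        (tx_packets q)%:R = r * P%:R
      & forall L : nat, (0 < L)%N ->
          decodable (with_subfile_length q L)
          /\ demand_private (with_subfile_length q L)].

(** * Piecewise linear curves *)

Definition on_segment (R : realType) (a b p : R * R) : Prop :=
  exists2 t : R, 0 <= t <= 1 &
    p = ((1 - t) * a.1 + t * b.1, (1 - t) * a.2 + t * b.2).

Definition on_polyline (R : realType) (pts : seq (R * R)) (p : R * R) : Prop :=
  exists2 k : nat, (k.+1 < size pts)%N &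
    on_segment (nth (0, 0) pts k) (nth (0, 0) pts k.+1) p.

(* Main.v *)
Require Import Defs.
From HB Require Import structures.
From mathcomp Require Import all_boot all_order all_algebra.
From mathcomp Require Import all_classical all_reals all_analysis.
From mathcomp Require Import lra zify.

(** Replace user [i] by [N] virtual users [(i, k)] and serve only the demand
    vectors in which [(i, k)] wants file [e i + k] for some [e]. The server
    secretly tells user [i] to act as virtual user [(i, s i)], with [s] uniform,
    and multicasts the transmission for [e = D - s] together with [e] itself:
    user [i] obtains file [e i + s i = D i], while [e j] is uniform and
    independent of [D j] for [j != i]. Hence only decodability has to be
    arranged, which for [K = N = 2] is done by two explicit tables with
    subpacketization three. The other points follow by splitting the files
    between two such schemes. *)

Set Implicit Arguments.
Unset Strict Implicit.
Unset Printing Implicit Defensive.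

Import Order.TTheory GRing.Theory Num.Theory.

Local Open Scope ring_scope.

(** * Criteria for vanishing conditional entropy and mutual information *)

Section Information.
Context (R : realType) (Om A B : finType) (P : Om -> R).

Lemma log2_1 : log2 (1 : R) = 0.
Proof. by rewrite /log2 ln1 mul0r. Qed.

Lemma log2_ge0 (x : R) : 1 <= x -> 0 <= log2 x.
Proof. by move=> x1; rewrite /log2 divr_ge0 ?ln_ge0 // ler1n. Qed.

Lemma rv_pmf_marginal (X : Om -> A) (Y : Om -> B) y :
  rv_pmf P Y y = \sum_x rv_pmf P (fun w => (X w, Y w)) (x, y).
Proof.
rewrite /rv_pmf (partition_big X predT) //=; apply: eq_bigr => x _.
by apply: eq_bigl => w; rewrite xpair_eqE andbC.
Qed.

Lemma sum_rv_pmf (C : finType) (X : Om -> C) : \sum_x rv_pmf P X x = \sum_w P w.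
Proof. by rewrite [RHS](partition_big X predT). Qed.

(** Whenever the event [X = x, Y = y] is nonempty it equals the event [Y = y], so every logarithm is
    log 1. *)
Lemma cond_entropy_eq0 (X : Om -> A) (Y : Om -> B) :
  (forall w w', Y w = Y w' -> X w = X w') -> cond_entropy P X Y = 0.
Proof.
move=> XY; rewrite /cond_entropy; apply/eqP; rewrite oppr_eq0; apply/eqP.
apply: big1 => x _; apply: big1 => y _ /=.
set pxy := rv_pmf _ _ _.
have [[w /andP[/eqP wx /eqP wy]]|none] :=
    pselect (exists w, (X w == x) && (Y w == y)).
  have -> : rv_pmf P Y y = pxy.
    apply: eq_bigl => w'; rewrite xpair_eqE.
    have [Yw'|] := eqVneq (Y w') y; last by rewrite andbF.
    by rewrite andbT -wx (XY w' w) ?eqxx // Yw' wy.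
  have [->|p0] := eqVneq pxy 0; first by rewrite mul0r.
  by rewrite divff // log2_1 mulr0.
suff -> : pxy = 0 by rewrite mul0r.
apply: big_pred0 => w; rewrite xpair_eqE.
by apply/negP => h; apply: none; exists w.
Qed.

(** Constancy in [y] gives p(x) = |B| p(x, y), and total mass 1 gives p(y) = 1 / |B|; the joint law
    is therefore the product law. *)
Lemma mutual_info_eq0 (X : Om -> A) (Y : Om -> B) :
  \sum_w P w = 1 ->
  (forall x y y', rv_pmf P (fun w => (X w, Y w)) (x, y) =
                  rv_pmf P (fun w => (X w, Y w)) (x, y')) ->
  mutual_info P X Y = 0.
Proof.
move=> P1 unif; apply: big1 => x _; apply: big1 => y _ /=.
set pxy := rv_pmf _ _ _.
suff -> : rv_pmf P X x * rv_pmf P Y y = pxy.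
  have [->|p0] := eqVneq pxy 0; first by rewrite mul0r.
  by rewrite divff // log2_1 mulr0.
have pX : rv_pmf P X x = pxy *+ #|B|.
  transitivity (\sum_(y' : B) pxy); last by rewrite sumr_const.
  rewrite /rv_pmf (partition_big Y predT) //=; apply: eq_bigr => y' _.
  rewrite /pxy (unif x y y'); apply: eq_bigl => w.
  by rewrite xpair_eqE.
have pY : rv_pmf P Y y *+ #|B| = 1.
  rewrite -P1 -(sum_rv_pmf Y) -sumr_const; apply: eq_bigr => y' _.
  rewrite !(rv_pmf_marginal X); apply: eq_bigr => x' _; exact: unif.
by rewrite pX mulrnAl -mulrnAr pY mulr1.
Qed.

End Information.

(** * Private schemes from virtual users *)

Section VirtualUsers.
Context (R : realType) (K n : nat).

Let N := n.+1.

(** A form of decodability free of probability. Writing the number of files as [n.+1] makes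
    [e i + k] an addition modulo [N]. *)
Definition virtual_decodable F m t
    (vc : 'I_K -> 'I_N -> files N F -> 'rV['F_2]_m)
    (vt : demands K N -> files N F -> 'rV['F_2]_t) : Prop :=
  forall i k e W W', vc i k W = vc i k W' -> vt e W = vt e W' ->
    W (e i + k) = W' (e i + k).

Definition unif_pmf (T : finType) (_ : T) : R := #|T|%:R^-1.

Lemma unif_pmf_ge0 (T : finType) (x : T) : 0 <= unif_pmf x.
Proof. by rewrite invr_ge0. Qed.

Lemma unif_pmf_sum1 (T : finType) (x : T) : \sum_y @unif_pmf T y = 1.
Proof.
rewrite sumr_const -[LHS]mulr_natl divff // pnatr_eq0.
by rewrite -lt0n; apply/card_gt0P; exists x.
Qed.

Definition keyed_scheme F m t
    (vc : 'I_K -> 'I_N -> files N F -> 'rV['F_2]_m)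
    (vt : demands K N -> files N F -> 'rV['F_2]_t) : scheme R K N F :=
  {| seed := demands K N;
     seed_pmf := @unif_pmf (demands K N);
     seed_pmf_ge0 := @unif_pmf_ge0 _;
     seed_pmf_sum1 := unif_pmf_sum1 (0 : demands K N);
     cache_bits := m;
     tx_bits := t;
     cache_header := 'I_N;
     tx_header := demands K N;
     cache := fun i s => vc i (s i);
     cache_head := fun i s => s i;
     tx := fun D s => vt (D - s);
     tx_head := fun D s => D - s |}.

Lemma outcome_pmf_sum1 F (c : scheme R K N F) :
  \sum_w @outcome_pmf R K N F c w = 1.
Proof.
have dem0 : #|demands K N|%:R != 0 :> R.
  by rewrite pnatr_eq0 -lt0n; apply/card_gt0P; exists 0.
have fil0 : #|files N F|%:R != 0 :> R.
  by rewrite pnatr_eq0 -lt0n; apply/card_gt0P; exists 0.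
rewrite -(pair_bigA _ (fun x y => outcome_pmf (x, y) : R)) /=.
rewrite -(pair_bigA _ (fun x y => \sum_z outcome_pmf (x, y, z) : R)) /=.
rewrite -(seed_pmf_sum1 c); apply: eq_bigr => s _.
rewrite (eq_bigr (fun=> seed_pmf s / #|files N F|%:R)) => [|W _].
  by rewrite sumr_const -[LHS]mulr_natr divfK.
rewrite /outcome_pmf /= sumr_const -[LHS]mulr_natr invfM mulrA.
by rewrite divfK.
Qed.

Section Keyed.
Context (F m t : nat) (vc : 'I_K -> 'I_N -> files N F -> 'rV['F_2]_m)
  (vt : demands K N -> files N F -> 'rV['F_2]_t).

Lemma keyed_decodable :
  virtual_decodable vc vt -> decodable (keyed_scheme vc vt).
Proof.
move=> dec i; apply: cond_entropy_eq0 => -[[s W] D] [[s' W'] D'].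
rewrite /rv_received /rv_demanded_file /= => -[cW sE tW eE].
(* The two headers reveal [s i] and [D - s], so both outcomes ask for the same file, although [s]
   and [s'] may differ elsewhere. *)
have DE : D i = D' i.
  have /ffunP/(_ i) := eE.
  by rewrite !ffunE sE => /addIr.
have -> : D i = (D - s) i + s i by rewrite !ffunE subrK.
rewrite (dec i (s i) (D - s) W W') //.
- by rewrite !ffunE subrK DE.
- by rewrite cW sE.
- by rewrite tW eE.
Qed.

(* Translating [D j] and [s j] together changes [D j] but nothing that user [i]
   sees. *)
Lemma keyed_private : demand_private (keyed_scheme vc vt).
Proof.
move=> i j ij; apply: mutual_info_eq0; first exact: outcome_pmf_sum1.
move=> u y y'.
pose d : demands K N := [ffun k => if k == j then y - y' else 0].
have di : d i = 0 by rewrite ffunE (negPf ij).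
have dj : d j = y - y' by rewrite ffunE eqxx.
pose h (w : outcome (keyed_scheme vc vt)) :
  outcome (keyed_scheme vc vt) := (w.1.1 + d, w.1.2, w.2 + d).
have h_inj : injective h.
  by move=> [[s W] D] [[s' W'] D'] /= [/addIr -> -> /addIr ->].
rewrite /rv_pmf (reindex_inj h_inj) /=; apply: eq_big => -[[s W] D] //=.
rewrite /h /rv_demand /rv_received /=.
have -> : D + d - (s + d) = D - s by rewrite opprD addrACA subrr addr0.
have -> : (D + d) i = D i by rewrite ffunE di addr0.
have -> : (s + d) i = s i by rewrite ffunE di addr0.
have -> : (D + d) j = D j + (y - y') by rewrite ffunE dj.
rewrite !xpair_eqE; congr (_ && _).
by rewrite eq_sym -subr_eq subKr eq_sym.
Qed.

End Keyed.
End VirtualUsers.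

(** * Elementary virtual schemes and their combination *)

Definition virtually_achieved K n F m t : Prop :=
  exists (vc : 'I_K -> 'I_n.+1 -> files n.+1 F -> 'rV['F_2]_m)
         (vt : demands K n.+1 -> files n.+1 F -> 'rV['F_2]_t),
    virtual_decodable vc vt.

Section Combining.
Context (K n : nat).

(** With two files this is the corner point (0, 2). *)
Lemma virtually_achieved_uncoded F :
  virtually_achieved K n F 0 (n.+1 * F).
Proof.
exists (fun _ _ _ => 0), (fun _ (W : files n.+1 F) => mxvec (\matrix_k W k)).
move=> i k e W W' _ /(can_inj mxvecK) /row_matrixP /(_ (e i + k)).
by rewrite !rowK.
Qed.

(** With two files this is the corner point (2, 0). *)
Lemma virtually_achieved_cached F :
  virtually_achieved K n F (n.+1 * F) 0.
Proof.
exists (fun _ _ (W : files n.+1 F) => mxvec (\matrix_k W k)), (fun _ _ => 0).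
move=> i k e W W' /(can_inj mxvecK) /row_matrixP /(_ (e i + k)) + _.
by rewrite !rowK.
Qed.

(** Memory sharing: both parts of the files are served with the same [k] and [e], so a single key
    suffices. *)
Lemma virtually_achieved_split F1 F2 m1 m2 t1 t2 :
  virtually_achieved K n F1 m1 t1 -> virtually_achieved K n F2 m2 t2 ->
  virtually_achieved K n (F1 + F2) (m1 + m2) (t1 + t2).
Proof.
move=> [vc1 [vt1 dec1]] [vc2 [vt2 dec2]].
pose fst_part (W : files n.+1 (F1 + F2)) : files n.+1 F1 :=
  [ffun k => lsubmx (W k)].
pose snd_part (W : files n.+1 (F1 + F2)) : files n.+1 F2 :=
  [ffun k => rsubmx (W k)].
exists (fun i k W => row_mx (vc1 i k (fst_part W)) (vc2 i k (snd_part W))).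
exists (fun e W => row_mx (vt1 e (fst_part W)) (vt2 e (snd_part W))).
move=> i k e W W' /eq_row_mx[c1 c2] /eq_row_mx[x1 x2].
have := dec1 _ _ _ _ _ c1 x1; have := dec2 _ _ _ _ _ c2 x2.
by rewrite !ffunE => eq2 eq1; rewrite -[LHS]hsubmxK -[RHS]hsubmxK eq1 eq2.
Qed.

(** Zero padding, used to reach exactly the rounded sizes that [achievable] prescribes. *)
Lemma virtually_achieved_leq F m m' t t' : (m <= m')%N -> (t <= t')%N ->
  virtually_achieved K n F m t -> virtually_achieved K n F m' t'.
Proof.
move=> /subnKC <- /subnKC <- [vc [vt dec]].
exists (fun i k W => row_mx (vc i k W) 0), (fun e W => row_mx (vt e W) 0).
by move=> i k e W W' /eq_row_mx[c _] /eq_row_mx[x _]; exact: dec c x.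
Qed.

End Combining.

(** * Rounding of sizes and negligible headers *)

(** Rounding up leaves a slack of less than one bit, which later absorbs the error of splitting
    files at an integer position. *)
Lemma nat_le_ceil (R : realType) (m : nat) (x : R) : m%:R < x + 1 ->
  exists2 c : nat, (m <= c)%N & Posz c = Num.ceil x.
Proof.
move=> mx; have : (Posz m - 1 < Num.ceil x)%R.
  by rewrite ceil_gt_int rmorphB /= mulr1z -pmulrn ltrBlDr.
by case: (Num.ceil x) => c h; [exists c => //; lia | lia].
Qed.

(** The number of possible headers does not depend on [F], so a large [F] makes them negligible.
    Divisibility by [d * b] forces [F] to be at least [b], which is chosen above
    [(h1 + h2) / eps]. *)
Lemma virtually_achieved_achievable (R : realType) K n (M r : R) :
  (forall d, (0 < d)%N -> exists F m t,
     [/\ (0 < F)%N /\ (d %| F)%N, virtually_achieved K n F m t,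
         m%:R < M * F%:R + 1 & t%:R < r * F%:R + 1]) ->
  achievable K n.+1 M r.
Proof.
move=> va eps d eps0 d0.
pose h1 := log2 (#|'I_n.+1|%:R : R).
pose h2 := log2 (#|demands K n.+1|%:R : R).
have h1_ge0 : 0 <= h1 by apply: log2_ge0; rewrite ler1n card_ord.
have h2_ge0 : 0 <= h2.
  by apply: log2_ge0; rewrite ler1n; apply/card_gt0P; exists 0.
pose b := (Num.trunc ((h1 + h2) / eps)).+1.
have [|F [m [t [[F0 dF] vaF mF tF]]]] := va (d * b)%N.
  by rewrite muln_gt0 d0.
have [m' mm' m'E] := nat_le_ceil mF; have [t' tt' t'E] := nat_le_ceil tF.
have [vc [vt dec]] := virtually_achieved_leq mm' tt' vaF.
have hF : h1 + h2 <= eps * F%:R.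
  rewrite mulrC -ler_pdivrMr //; apply: (le_trans (ltW (truncnS_gt _))).
  by rewrite ler_nat dvdn_leq // (dvdn_trans _ dF) // dvdn_mull.
exists F, (keyed_scheme R vc vt); split.
- by split=> //; apply: dvdn_trans dF; exact: dvdn_mulr.
- split; [exact: keyed_decodable | exact: keyed_private].
- by [].
- by apply: le_trans hF; rewrite lerDl.
- by apply: le_trans hF; rewrite lerDr.
Qed.

(** * Packet schemes and time sharing *)

Section Packets.
Context (K n P m t : nat).
Context (cc : 'I_K -> 'I_n.+1 -> 'I_m -> 'M['F_2]_(n.+1, P)).
Context (tc : demands K n.+1 -> 'I_t -> 'M['F_2]_(n.+1, P)).

Definition packet_decodable : Prop := forall L,
  virtual_decodable (fun i k => @concat_packets _ P L m (cc i k))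
                    (fun e => @concat_packets _ P L t (tc e)).

Lemma packet_decodable_achieved (R : realType) (M r : R) :
  packet_decodable -> m%:R = M * P%:R -> t%:R = r * P%:R ->
  achieved_with_subpacketization K n.+1 P M r.
Proof.
move=> dec mE tE.
exists {| pk_seed := demands K n.+1;
          pk_seed_pmf := @unif_pmf R (demands K n.+1);
          pk_seed_pmf_ge0 := @unif_pmf_ge0 R _;
          pk_seed_pmf_sum1 := unif_pmf_sum1 R (0 : demands K n.+1);
          cache_packets := m;
          tx_packets := t;
          pk_cache_header := 'I_n.+1;
          pk_tx_header := demands K n.+1;
          cache_coef := fun i s => cc i (s i);
          pk_cache_head := fun i s => s i;
          tx_coef := fun D s => tc (D - s);
          pk_tx_head := fun D s => D - s |}.
(* For each [L] this packet scheme unfolds to the keyed scheme of the concatenated packets. *)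
split=> // L _; split.
  exact: (keyed_decodable R (dec L)).
exact: (@keyed_private R K n _ _ _
  (fun i k => @concat_packets _ P L m (cc i k))
  (fun e => @concat_packets _ P L t (tc e))).
Qed.

Lemma packet_decodable_virtually_achieved L : packet_decodable ->
  virtually_achieved K n (P * L) (m * L) (t * L).
Proof.
move=> dec; exists (fun i k => @concat_packets _ P L m (cc i k)).
by exists (fun e => @concat_packets _ P L t (tc e)).
Qed.

Lemma concat_packets_inj L (a : 'I_m -> 'M['F_2]_(n.+1, P))
    (W W' : files n.+1 (P * L)) k :
  concat_packets a W = concat_packets a W' -> packet (a k) W = packet (a k) W'.
Proof.
by move=> /(can_inj mxvecK) /row_matrixP/(_ k); rewrite !rowK.
Qed.

End Packets.

(* If the fractional part of [x d] lies in [1/3, 1/2] then no integer is close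
   enough to it, but [f = 2 d] works. *)
Lemma approx_multiple (R : realType) (x : R) (d : nat) : 0 <= x <= 1 ->
  (0 < d)%N -> exists f b : nat,
    [/\ (0 < f)%N, (d %| f)%N, (b <= f)%N, x * f%:R - 1 / 3 < b%:R
      & b%:R < x * f%:R + 1 / 2].
Proof.
move=> /andP[x0 x1] d0.
have bound (f b : nat) : b%:R < x * f%:R + 1 / 2 -> (b <= f)%N.
  move=> bf; rewrite -ltnS -(ltr_nat R) -natr1.
  by have : x * f%:R <= f%:R := ler_piMl (ler0n _ _) x1; lra.
pose k := Num.trunc (x * d%:R).
have /andP[k1 k2] : k%:R <= x * d%:R < k.+1%:R.
  by rewrite truncn_itv // mulr_ge0.
rewrite -natr1 in k2.
have cases (f b : nat) : (0 < f)%N -> (d %| f)%N ->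
    x * f%:R - 1 / 3 < b%:R -> b%:R < x * f%:R + 1 / 2 ->
    exists f b : nat, [/\ (0 < f)%N, (d %| f)%N, (b <= f)%N,
      x * f%:R - 1 / 3 < b%:R & b%:R < x * f%:R + 1 / 2].
  by move=> *; exists f, b; split=> //; exact: bound.
have [c1|c1] := ltP (x * d%:R) (k%:R + 1 / 3).
  by apply: (cases d k) => //; lra.
have [c2|c2] := ltP (k%:R + 1 / 2) (x * d%:R).
  by apply: (cases d k.+1) => //; rewrite -[k.+1%:R]natr1; lra.
apply: (cases (d * 2)%N (k * 2).+1).
- by rewrite muln_gt0 d0.
- exact: dvdn_mulr.
- by rewrite -[(k * 2).+1%:R]natr1 !natrM mulrA; lra.
- by rewrite -[(k * 2).+1%:R]natr1 !natrM mulrA; lra.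
Qed.

(** Files of [3 * f] bits are split so that [b] of the [f] units use the second scheme, with b / f
    close to [x], which may be irrational. The bounds 3 and 2 fit the steepest segments: in thirds
    of a file, one coordinate falls by 3 while the other rises by 2. *)
Lemma time_sharing_achievable (R : realType) K n m1 t1 m2 t2 (M r x : R) :
  (forall L, virtually_achieved K n (3 * L) (m1 * L) (t1 * L)) ->
  (forall L, virtually_achieved K n (3 * L) (m2 * L) (t2 * L)) ->
  (m1 <= m2 + 3)%N -> (m2 <= m1 + 2)%N -> (t1 <= t2 + 3)%N -> (t2 <= t1 + 2)%N ->
  0 <= x <= 1 ->
  M * 3 = (1 - x) * m1%:R + x * m2%:R -> r * 3 = (1 - x) * t1%:R + x * t2%:R ->
  achievable K n.+1 M r.
Proof.
move=> va1 va2 m12 m21 t12 t21 x01 ME rE.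
apply: virtually_achieved_achievable => d d0.
have [f [b [f0 df bf bge ble]]] := approx_multiple x01 d0.
exists (3 * f)%N, (m1 * (f - b) + m2 * b)%N, (t1 * (f - b) + t2 * b)%N.
have interpolate (p q : nat) (y : R) : (p <= q + 3)%N -> (q <= p + 2)%N ->
    y * 3 = (1 - x) * p%:R + x * q%:R ->
    (p * (f - b) + q * b)%:R < y * (3 * f)%:R + 1.
  rewrite [(3 * f)%:R]natrM -(ler_nat R) -(ler_nat R q) !natrD => pq qp yE.
  rewrite !natrM (natrB _ bf) mulrA yE.
  (* The product is the excess over the target size. Its second factor lies strictly between -1/3
     and 1/2 and its first between -3 and 2, which is where the window of [approx_multiple] comes
     from. *)
  suff : (q%:R - p%:R) * (b%:R - x * f%:R) < 1 by lra.
  have [le0|gt0] := lerP (b%:R - x * f%:R) 0.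
    have : 0 <= (q%:R + 3 - p%:R) * (x * f%:R - b%:R) by rewrite mulr_ge0; lra.
    lra.
  have : 0 <= (p%:R + 2 - q%:R) * (b%:R - x * f%:R) by rewrite mulr_ge0; lra.
  lra.
split.
- by rewrite muln_gt0 f0 dvdn_mull.
- have -> : (3 * f = 3 * (f - b) + 3 * b)%N by rewrite -mulnDr subnK.
  exact: virtually_achieved_split.
- exact: interpolate.
- exact: interpolate.
Qed.

(** * Sums of subfiles and parity checks *)

Section SubfileSums.
Context (K n P : nat).

Let N := n.+1.

Definition subfile_sum (s : seq ('I_N * 'I_P)) : 'M['F_2]_(N, P) :=
  \sum_(q <- s) delta_mx q.1 q.2.

Definition subfile_sums m (ss : seq (seq ('I_N * 'I_P))) (p : 'I_m) :
    'M['F_2]_(N, P) :=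
  subfile_sum (nth [::] ss p).

Lemma packet_subfile_sum L (W : files N (P * L)) s :
  packet (subfile_sum s) W = \sum_(q <- s) subfile W q.1 q.2.
Proof.
rewrite /packet /subfile_sum; under eq_bigr do under eq_bigr do
  rewrite summxE scaler_suml.
under eq_bigr do rewrite exchange_big /=.
rewrite exchange_big /=; apply: eq_bigr => -[k j] _ /=.
rewrite (bigD1 k) //= (bigD1 j) //= mxE !eqxx scale1r !big1 ?addr0 //.
- by move=> k' /negPf kk'; apply: big1 => j' _; rewrite mxE kk' scale0r.
- by move=> j' /negPf jj'; rewrite mxE jj' andbF scale0r.
Qed.

(** Summation over F_2 in boolean form, so that table checks reduce by computation. *)
Definition parity (y : 'I_N * 'I_P -> bool) (s : seq ('I_N * 'I_P)) : bool :=
  foldr (fun q b => y q (+) b) false s.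

Lemma sum_F2_neq0 (x : 'I_N * 'I_P -> 'F_2) s :
  (\sum_(q <- s) x q != 0) = parity (fun q => x q != 0) s.
Proof.
elim: s => [|q s IH]; first by rewrite big_nil eqxx.
rewrite big_cons /= -IH; move: (x q) (\sum_(_ <- _) _).
by move=> [[|[|//]] ?] [[|[|//]] ?].
Qed.

(* Packets act separately on each position within the subfiles, so it suffices to
   treat subfiles of one bit; [y] is the difference of two families of files. *)
Lemma subfile_sums_decodable m t
    (cs : 'I_K -> 'I_N -> seq (seq ('I_N * 'I_P)))
    (ts : demands K N -> seq (seq ('I_N * 'I_P))) :
  (forall i k, size (cs i k) = m) -> (forall e, size (ts e) = t) ->
  (forall i k e j y, all (fun s => ~~ parity y s) (cs i k ++ ts e) ->
     ~~ y (e i + k, j)) ->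
  packet_decodable (fun i k => @subfile_sums m (cs i k))
                   (fun e => @subfile_sums t (ts e)).
Proof.
move=> csz tsz dec L i k e W W' hc ht.
apply: (can_inj vec_mxK); apply/row_matrixP => j; apply/rowP => l.
pose x q := subfile W q.1 q.2 0 l - subfile W' q.1 q.2 0 l.
have sum0 p (ss : seq (seq ('I_N * 'I_P))) : size ss = p ->
    concat_packets (@subfile_sums p ss) W =
    concat_packets (@subfile_sums p ss) W' ->
    all (fun s => ~~ parity (fun q => x q != 0) s) ss.
  move=> ssz eqW; apply/(all_nthP [::]) => a; rewrite ssz => ap.
  have := concat_packets_inj (Ordinal ap) eqW.
  rewrite !packet_subfile_sum /= => /rowP/(_ l) /eqP.
  by rewrite -sum_F2_neq0 negbK sumrB !summxE subr_eq0.
have := dec i k e j (fun q => x q != 0).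
rewrite all_cat (sum0 _ _ (csz i k) hc) (sum0 _ _ (tsz e) ht) => /(_ isT).
by rewrite negbK subr_eq0 => /eqP.
Qed.

End SubfileSums.

(* The digits of [cache23], [tx32] etc. are the numbers of packets in a cache and
   in a transmission. The tables were found by computer search. *)
Local Notation A j := ((0, j) : 'I_2 * 'I_3).
Local Notation B j := ((1, j) : 'I_2 * 'I_3).

Definition cache23 (i k : 'I_2) : seq (seq ('I_2 * 'I_3)) :=
  match val i, val k with
  | 0%N, 0%N => [:: [:: A 0]; [:: B 0]]
  | 0%N, _ => [:: [:: A 1]; [:: B 1]]
  | _, 0%N => [:: [:: A 2]; [:: B 2]]
  | _, _ => [:: [:: A 0; A 1; A 2]; [:: B 0; B 1; B 2]]
  end.

Definition tx23 (e : demands 2 2) : seq (seq ('I_2 * 'I_3)) :=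
  match val (e 0), val (e 1) with
  | 0%N, 0%N => [:: [:: A 0; A 2]; [:: A 1; B 0]; [:: A 1; B 2]]
  | 0%N, _ => [:: [:: A 1; A 2]; [:: A 1; B 0]; [:: B 1; B 2]]
  | _, 0%N => [:: [:: A 1; A 2]; [:: A 0; B 1]; [:: A 0; B 2]]
  | _, _ => [:: [:: A 0; A 2]; [:: A 0; B 1]; [:: B 0; B 2]]
  end.

Definition cache32 (i k : 'I_2) : seq (seq ('I_2 * 'I_3)) :=
  match val i, val k with
  | 0%N, 0%N => [:: [:: A 0]; [:: A 1]; [:: B 0]]
  | 0%N, _ => [:: [:: A 0]; [:: A 2]; [:: B 1]]
  | _, 0%N => [:: [:: A 1]; [:: A 2]; [:: B 2]]
  | _, _ => [:: [:: A 0; A 1]; [:: A 0; A 2]; [:: B 0; B 1; B 2]]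
  end.

Definition tx32 (e : demands 2 2) : seq (seq ('I_2 * 'I_3)) :=
  match val (e 0), val (e 1) with
  | 0%N, 0%N => [:: [:: B 0; B 2]; [:: A 0; A 2; B 0]]
  | 0%N, _ => [:: [:: A 2; B 0]; [:: B 1; B 2]]
  | _, 0%N => [:: [:: B 1; B 2]; [:: A 0; A 1; B 1]]
  | _, _ => [:: [:: A 1; B 1]; [:: B 0; B 2]]
  end.

(** * Exhaustive verification of the tables *)

Lemma I2P (z : 'I_2) : z = 0 \/ z = 1.
Proof. by case: z => [[|[|//]] ?]; [left | right]; apply: val_inj. Qed.

Lemma I3P (z : 'I_3) : [\/ z = 0, z = 1 | z = 2].
Proof.
by case: z => [[|[|[|//]]] ?];
   [constructor 1 | constructor 2 | constructor 3]; apply: val_inj.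
Qed.

(** Replaces a quantifier over functions by one over six booleans, which can be enumerated; subfile
    [j] of file [k] sits at position 3 k + j. *)
Lemma bit_pattern_ind (Q : ('I_2 * 'I_3 -> bool) -> Prop) :
  (forall a0 a1 a2 b0 b1 b2 : bool,
     Q (fun q => nth false [:: a0; a1; a2; b0; b1; b2] (3 * q.1 + q.2))) ->
  forall y, Q y.
Proof.
move=> Qbits y.
rewrite (_ : y = fun q => nth false [:: y (A 0); y (A 1); y (A 2);
  y (B 0); y (B 1); y (B 2)] (3 * q.1 + q.2)); first exact: Qbits.
by apply/funext => -[k j]; have [->|->] := I2P k; have [->|->|->] := I3P j.
Qed.

(** After the table lengths, decodability is checked for each virtual user, each [e], each subfile
    and all 64 difference patterns. *)
Local Ltac check_tables :=
  apply: subfile_sums_decodable => [i k|e|i k e j];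
  [ by have [->|->] := I2P i; have [->|->] := I2P k
  | by rewrite /tx23 /tx32;
       have [->|->] := I2P (e 0); have [->|->] := I2P (e 1)
  | rewrite /tx23 /tx32;
    have [->|->] := I2P i; have [->|->] := I2P k;
    have [->|->] := I2P (e 0); have [->|->] := I2P (e 1);
    have [->|->|->] := I3P j;
    by apply: bit_pattern_ind => -[] [] [] [] [] [] ].

Lemma scheme23_decodable :
  packet_decodable (fun i k => @subfile_sums _ _ 2 (cache23 i k))
                   (fun e => @subfile_sums _ _ 3 (tx23 e)).
Proof. check_tables. Qed.

Lemma scheme32_decodable :
  packet_decodable (fun i k => @subfile_sums _ _ 3 (cache32 i k))
                   (fun e => @subfile_sums _ _ 2 (tx32 e)).
Proof. check_tables. Qed.

Theorem mainTheorem2 (R : realType) :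
  (forall M r : R,
     on_polyline [:: (0, 2); (2 / 3, 1); (1, 2 / 3); (2, 0)] (M, r) ->
     achievable 2 2 M r)
  /\ achieved_with_subpacketization 2 2 3 (1 : R) (2 / 3)
  /\ achieved_with_subpacketization 2 2 3 (2 / 3 : R) 1.
Proof.
split; last first.
  split.
    by apply: (packet_decodable_achieved scheme32_decodable); lra.
  by apply: (packet_decodable_achieved scheme23_decodable); lra.
(* The uncoded corners are rewritten with files of [3 * L] bits, so that all four corner schemes
   count sizes in thirds of a file. *)
have va06 L : virtually_achieved 2 1 (3 * L) (0 * L) (6 * L).
  have -> : (6 * L = 2 * (3 * L))%N by rewrite mulnA.
  exact: virtually_achieved_uncoded.
have va60 L : virtually_achieved 2 1 (3 * L) (6 * L) (0 * L).
  have -> : (6 * L = 2 * (3 * L))%N by rewrite mulnA.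
  exact: virtually_achieved_cached.
have va23 L := packet_decodable_virtually_achieved L scheme23_decodable.
have va32 L := packet_decodable_virtually_achieved L scheme32_decodable.
move=> M r [[|[|[|//]]] _ [x /andP[x0 x1] [-> ->]]] /=.
- by apply: (time_sharing_achievable va06 va23 (x := x)) => //; lra.
- by apply: (time_sharing_achievable va23 va32 (x := x)) => //; lra.
(* [time_sharing_achievable] allows the cache to shrink by 3 but to grow only by
   2, hence the reversed segment. *)
- by apply: (time_sharing_achievable va60 va32 (x := 1 - x)) => //; lra.
Qed.
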